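(* Let $A$ be a $C^*$-algebra, let $B\subset A$ be a non-degenerate abelian $C^*$-subalgebra, and let $\mathbb{E}:A\to B$ be a conditional expectation which is normalized by every element of some set $N_0\subset N(B)$. For a state $\phi\in S(B)$, the following are equivalent: (i) $\phi$ is $N_0$-invariant; (ii) $\phi\circ\mathbb{E}$ is centralized by all elements of the $C^*$-subalgebra $C^*(B\cup N_0)\subset A$ generated by $B\cup N_0$; (iii) the restriction $(\phi\circ\mathbb{E})|_{C^*(B\cup N_0)}$ is a tracial state on $C^*(B\cup N_0)$.
   Context: $S(B)$ is the set of states on $B$. A $C^*$-subalgebra $B\subset A$ is non-degenerate if $B$ contains an approximate unit for $A$. An element $n\in A$ normalizes $B$ if $nBn^*\cup n^*Bn\subset B$; $N(B)=N_A(B)$ is the set of all such $n$. For $n\in N(B)$, a state $\phi$ on $B$ is $n$-invariant if $\phi(nbn^* )=\phi(n^*nb)$ for all $b\in B$ (by non-degeneracy, $n^*n\in B$); it is $N_0$-invariant if it is $n$-invariant for all $n\in N_0$. A map $\Phi:A\to B$ is normalized by $n\in N(B)$ if $\Phi(nan^* )=n\Phi(a)n^*$ for all $a\in A$. A state $\psi\in S(A)$ is centralized by $x\in A$ if $\psi(xa)=\psi(ax)$ for all $a\in A$. A tracial state on a $C^*$-algebra is a state $\tau$ with $\tau(xy)=\tau(yx)$ for all $x,y$. *)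

(* Defs.v *)
From HB Require Import structures.
From mathcomp Require Import all_boot all_order all_algebra.
From mathcomp Require Import all_classical all_reals all_analysis.
From mathcomp Require Import complex.

Set Implicit Arguments.
Unset Strict Implicit.
Unset Printing Implicit Defensive.

Import Order.TTheory GRing.Theory Num.Theory.
Import numFieldNormedType.Exports.

Local Open Scope classical_set_scope.
Local Open Scope ring_scope.
Local Open Scope complex_scope.

(* C*-algebras need not be unital, so MathComp's ring structures (which all
   have a unit) are not available; the product is part of the mixin.
   The norm of a normed module over R[i] takes its values in R[i]; they are
   nonnegative reals for the (partial) order of R[i]. *)
HB.mixin Record CompleteNormedModule_isCstarAlgebra (R : realType) A
    of CompleteNormedModule R[i] A := {
  cmul : A -> A -> A ;
  adj : A -> A ;
  cmulA : associative cmul ;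
  cmulDl : left_distributive cmul +%R ;
  cmulDr : right_distributive cmul +%R ;
  cscalerAl : forall (k : R[i]) (x y : A), k *: cmul x y = cmul (k *: x) y ;
  cscalerAr : forall (k : R[i]) (x y : A), k *: cmul x y = cmul x (k *: y) ;
  adjD : {morph adj : x y / x + y} ;
  adjZ : forall (k : R[i]) (x : A), adj (k *: x) = Num.conj k *: adj x ;
  adjM : forall x y : A, adj (cmul x y) = cmul (adj y) (adj x) ;
  adjK : involutive adj ;
  cnormM : forall x y : A, `|cmul x y| <= `|x| * `|y| ;
  cstar_identity : forall x : A, `|cmul (adj x) x| = `|x| ^+ 2
}.

#[short(type="cstarAlgType")]
HB.structure Definition CstarAlgebra (R : realType) :=
  {A of CompleteNormedModule R[i] A &
        CompleteNormedModule_isCstarAlgebra R A}.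

Notation "x ** y" := (cmul x y) (at level 40, left associativity) : ring_scope.

Section Cstar.
Context {R : realType} {A : cstarAlgType R}.
Implicit Types (B D S N : set A) (a b n x : A).

Definition cstar_subalgebra B : Prop :=
  [/\ B 0,
      forall (k : R[i]) x y, B x -> B y -> B (k *: x + y),
      forall x y, B x -> B y -> B (x ** y),
      forall x, B x -> B (adj x)
    & closed B].

Definition abelian_subalgebra B : Prop := forall x y, B x -> B y -> x ** y = y ** x.

(* C*(S) *)
Definition cstar_gen S : set A := smallest cstar_subalgebra S.

Definition positive_in D x : Prop := exists2 y, D y & x = adj y ** y.

(* The net is indexed by a type with a proper filter F; for a directed index
   set, F is the filter generated by the tails.  The net is not required to be
   increasing. *)
Definition approximate_unit (I : Type) (F : set_system I) (e : I -> A) : Prop :=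
  [/\ forall i, positive_in setT (e i),
      forall i, `|e i| <= 1
    & forall a, (e i ** a @[i --> F] --> a) /\ (a ** e i @[i --> F] --> a)].

Definition nondegenerate_subalgebra B : Prop :=
  exists (I : Type) (F : set_system I) (e : I -> A),
    [/\ ProperFilter F, approximate_unit F e & forall i, B (e i)].

(* Functionals on a C*-subalgebra D are represented by functions on A, of which
   only the restriction to D is ever considered. *)
Definition functional_norm D (psi : A -> R[i]) : \bar R :=
  ereal_sup [set (complex.Re `|psi x|)%:E | x in [set x | D x /\ `|x| <= 1]].

Definition state D (psi : A -> R[i]) : Prop :=
  [/\ forall (k : R[i]) x y, D x -> D y ->
        psi (k *: x + y) = k * psi x + psi y,
      forall x, positive_in D x -> 0 <= psi x
    & functional_norm D psi = 1%:E].

Definition tracial_state D (tau : A -> R[i]) : Prop :=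
  state D tau /\ forall x y, D x -> D y -> tau (x ** y) = tau (y ** x).

Definition cond_expectation B (E : {linear A -> A}) : Prop :=
  [/\ forall a, B (E a),
      forall b, B b -> E b = b,
      forall a b, B b -> E (b ** a) = b ** E a /\ E (a ** b) = E a ** b,
      forall a, positive_in setT a -> positive_in B (E a)
    & forall a, `|E a| <= `|a|].

(* N(B) *)
Definition normalizers B : set A :=
  [set n | forall b, B b -> B (n ** b ** adj n) /\ B (adj n ** b ** n)].

Definition normalized_by (Phi : A -> A) n : Prop :=
  forall a, Phi (n ** a ** adj n) = n ** Phi a ** adj n.

Definition invariant_under B (phi : A -> R[i]) n : Prop :=
  forall b, B b -> phi (n ** b ** adj n) = phi (adj n ** n ** b).

Definition set_invariant B (phi : A -> R[i]) N : Prop :=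
  forall n, N n -> invariant_under B phi n.

Definition centralized_by (psi : A -> R[i]) x : Prop :=
  forall a, psi (x ** a) = psi (a ** x).

End Cstar.

(* Main.v *)
Require Import Defs.
From mathcomp Require Import all_boot all_order all_algebra.
From mathcomp Require Import all_classical all_reals all_analysis.
From mathcomp Require Import complex ring lra.

Set Implicit Arguments.
Unset Strict Implicit.

Import Order.TTheory GRing.Theory Num.Theory.
Import numFieldNormedType.Exports.

Local Open Scope classical_set_scope.
Local Open Scope ring_scope.
Local Open Scope complex_scope.

(** Write psi for phi o E, a positive functional of norm at most 1 on A. Its
    centralizer Z, the set of x with psi (x a) = psi (a x) for all a, is a
    C*-subalgebra of A, because psi is continuous and hermitian; so the
    C*-algebra generated by B and N0 centralizes psi as soon as B and N0 do.
    Elements of B lie in Z because E is a B-bimodule map and B is abelian.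

    The heart of the matter is that every n in N0 lies in Z. Since E is
    normalized by n, invariance of phi under n extends to
    psi (n a n* ) = psi (n* n a) for all a in A. The trick is to put the
    product a n in place of a: together with the fact that n n* and n* n
    belong to B, hence to Z, this gives psi (n n* n a) = psi (a n n* n), that
    is, n n* n is in Z.

    To pass from n n* n to n (lemma centralized_by_of_triple_product) one
    could use continuous functional calculus, n being a norm limit of p(n n* ) n
    with p(0) = 0. A more elementary route only approximates n in the
    seminorms x |-> psi (x x* )^(1/2) and x |-> psi (x* x)^(1/2), which is
    enough by Cauchy-Schwarz. After scaling, n has norm at most 1; put
    h = n n*. The residual y_k = (1 - h)^k n differs from n by an element
    of Z, so psi (n x) - psi (x n) = psi (y_k x) - psi (x y_k), and it remains
    to see that psi (y_k y_k* ) = psi (h (1 - h)^2k) tends to 0 (the other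
    seminorm is the same statement for n*, as y_k* is the residual of n* ).
    These numbers are nonnegative; they decrease by
    psi (h^2 (1 - h)^2k (2 - h)), which is at least psi (h^2 (1 - h)^2k)
    because psi (v h v* ) <= psi (v v* ) (lemma contraction). Hence some of
    these decrements are arbitrarily small, while
    psi (h (1 - h)^k)^2 <= psi (h^2 (1 - h)^2k) by Cauchy-Schwarz.

    The other implications are short: a positive element of the generated
    algebra has a positive image in B, and phi o E has the norm of phi because
    E is contractive and fixes B; finally, tau (n (b n* )) = tau ((b n* ) n) is
    n-invariance once E is seen to fix n b n* and b n* n.

    Estimates are done with the real-valued functional f = Re psi, which is
    real linear and determines the centralizer of psi. *)

(** * Real and complex numbers *)

Section RealAndComplexNumbers.
Context {R : realType}.
Implicit Types z : R[i].

Lemma complex_ge0E z : 0 <= z -> z = (complex.Re z)%:C.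
Proof. by move=> /ger0_Im; case: z => a b /= ->. Qed.

Lemma ReD z w : complex.Re (z + w) = complex.Re z + complex.Re w.
Proof. by case: z; case: w. Qed.

Lemma ReZ (t : R) z : complex.Re (t%:C * z) = t * complex.Re z.
Proof. by case: z => a b /=; rewrite mul0r subr0. Qed.

(** If [c 0] exceeded [b], each squaring step would add at least [c 0 - b]
    to the previous term, so [c] would grow at least linearly. The hypothesis
    on squares is what Cauchy-Schwarz gives for the values of a positive
    functional at h, h^2, h^4, h^8, and so on. *)
Lemma le_of_squaring_bound (b C : R) (c : nat -> R) :
  0 <= b -> (forall k, c k ^+ 2 <= b * c k.+1) -> (forall k, c k <= C) ->
  c 0 <= b.
Proof.
move=> b0 cS cC; rewrite leNgt; apply/negP => bc.
have b_gt0 : 0 < b.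
  rewrite lt_neqAle b0 andbT; apply/eqP => bE.
  have := cS 0; rewrite -bE mul0r; rewrite -bE in bc.
  by have := exprn_gt0 2 bc; lra.
have growth k : b + k.+1%:R * (c 0 - b) <= c k.
  elim: k => [|k IH]; first by lra.
  rewrite -(ler_pM2l b_gt0); apply: le_trans (cS k).
  set d := c 0 - b in IH *; have d0 : 0 < d by rewrite subr_gt0.
  have m1 : (1 : R) <= k.+1%:R by rewrite ler1n.
  rewrite [k.+2%:R](_ : _ = k.+1%:R + 1); last by rewrite -[in LHS]addn1 natrD.
  move: IH m1; set m := k.+1%:R => IH m1.
  have md : d <= m * d by rewrite ler_peMl // ltW.
  have : (b + m * d) ^+ 2 <= c k ^+ 2.
    by rewrite lerXn2r ?nnegrE //; nra.
  by apply: le_trans; nra.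
have q0 : 0 <= `|C - b| / (c 0 - b) by rewrite divr_ge0 // subr_ge0 ltW.
have := archi_boundP q0; set N := Num.bound _ => hN.
have d0 : 0 < c 0 - b by rewrite subr_gt0.
have := growth N; have := cC N; have := ler_norm (C - b).
move: hN; rewrite ltr_pdivrMr // -[N.+1%:R]natr1; nra.
Qed.

(** [c] loses at least e^2 between 2j and 2j+1 as long as it stays above e,
    which a nonnegative sequence cannot do forever. *)
Lemma vanishing_of_square_decrements (c : nat -> R) :
  (forall k, 0 <= c k) -> (forall k, c k.+1 <= c k) ->
  (forall j, c j ^+ 2 <= c j.*2 - c j.*2.+1) ->
  forall eps, 0 < eps -> exists K, forall k, (K <= k)%N -> c k < eps.
Proof.
move=> c0 cS c2 eps eps0; apply: contrapT => /forallNP big.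
have mono K k : (K <= k)%N -> c k <= c K.
  by apply: (@homo_leq _ c (fun x y => y <= x)) => // x y z /[swap];
  apply: le_trans.
have ge_eps K : eps <= c K.
  rewrite leNgt; apply/negP => cK; apply: (big K) => k /mono.
  by move=> /le_lt_trans; apply.
have drop j : c j.*2 <= c 0 - j%:R * eps ^+ 2.
  elim: j => [|j IH]; first by rewrite double0 mul0r subr0.
  have := mono _ _ (leqnSn j.*2.+1); rewrite -doubleS => le1.
  have : eps ^+ 2 <= c j ^+ 2 by rewrite lerXn2r ?nnegrE // ltW.
  by have := c2 j; rewrite -[j.+1%:R]natr1; lra.
have e2 : 0 < eps ^+ 2 by rewrite exprn_gt0.
have q0 : 0 <= c 0 / eps ^+ 2 by rewrite divr_ge0 // ltW.
have := archi_boundP q0; set N := Num.bound _.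
rewrite ltr_pdivrMr // => hN.
by have := drop N; have := c0 N.*2; lra.
Qed.

End RealAndComplexNumbers.

(** * Elementary facts on C*-algebras *)

Section CstarAlgebra.
Context {R : realType} {A : cstarAlgType R}.
Implicit Types x y z : A.

(** The norm of [A] as a real number instead of a nonnegative complex one. *)
Definition rnorm (x : A) : R := complex.Re `|x|.

Lemma normE x : `|x| = (rnorm x)%:C.
Proof. exact/complex_ge0E/normr_ge0. Qed.

Lemma rnorm_ge0 x : 0 <= rnorm x.
Proof. by rewrite -lecR -normE normr_ge0. Qed.

Lemma rnormN x : rnorm (- x) = rnorm x.
Proof. by rewrite /rnorm normrN. Qed.

Lemma rnormM x y : rnorm (x ** y) <= rnorm x * rnorm y.
Proof. by rewrite -lecR -normE rmorphM /= -!normE cnormM. Qed.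

Lemma rnormZ (t : R) x : 0 <= t -> rnorm (t%:C *: x) = t * rnorm x.
Proof.
move=> t0; apply: complexI; rewrite -normE normrZ rmorphM /= -normE.
by rewrite ger0_norm // ler0c.
Qed.

Lemma cmul0r x : 0 ** x = 0.
Proof. by rewrite -[0 in LHS](scale0r (0 : A)) -cscalerAl scale0r. Qed.

Lemma cmulr0 x : x ** 0 = 0.
Proof. by rewrite -[0 in LHS](scale0r (0 : A)) -cscalerAr scale0r. Qed.

Lemma cmulNr x y : (- x) ** y = - (x ** y).
Proof. by rewrite -scaleN1r -cscalerAl scaleN1r. Qed.

Lemma cmulrN x y : x ** (- y) = - (x ** y).
Proof. by rewrite -scaleN1r -cscalerAr scaleN1r. Qed.

Lemma cmulBl x y z : (x - y) ** z = x ** z - y ** z.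
Proof. by rewrite cmulDl cmulNr. Qed.

Lemma cmulBr x y z : z ** (x - y) = z ** x - z ** y.
Proof. by rewrite cmulDr cmulrN. Qed.

Lemma adjB x y : adj (x - y) = adj x - adj y.
Proof.
by rewrite adjD -scaleN1r Defs.adjZ rmorphN rmorph1 scaleN1r.
Qed.

Lemma adjZ_real (t : R) x : adj (t%:C *: x) = t%:C *: adj x.
Proof.
rewrite Defs.adjZ conj_Creal //.
by rewrite complex_real eqxx.
Qed.

(** From |y|^2 = |y* y| <= |y*| |y|, applied to both [x] and [adj x]. *)
Lemma rnorm_adj x : rnorm (adj x) = rnorm x.
Proof.
have le y : rnorm y <= rnorm (adj y).
  have : rnorm y ^+ 2 <= rnorm (adj y) * rnorm y.
    apply: le_trans (rnormM _ _).
    by rewrite -lecR rmorphXn /= -!normE cstar_identity.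
  have := rnorm_ge0 y; have := rnorm_ge0 (adj y); nra.
by apply/eqP; rewrite eq_le le -{2}(adjK x) le.
Qed.

Lemma positive_in_mul_adj (y : A) : positive_in setT (y ** adj y).
Proof. by exists (adj y) => //; rewrite adjK. Qed.

Lemma positive_adj (p : A) : positive_in setT p -> adj p = p.
Proof. by case=> y _ ->; rewrite adjM adjK. Qed.

Lemma closed_approx (D : set A) x : closed D ->
  (forall eps : R, 0 < eps -> exists2 y, D y & rnorm (x - y) < eps) -> D x.
Proof.
move=> clD ap; apply: clD => U /nbhs_ballP[e e0 eU].
have eE := complex_ge0E (ltW e0).
have [y Dy ye] : exists2 y, D y & rnorm (x - y) < complex.Re e.
  by apply: ap; rewrite -ltcR -eE.
exists y; split=> //; apply: eU.
by rewrite -ball_normE /= normE eE ltcR.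
Qed.

(** A single member of the net serves two elements, one on each side: passing
    from [x] to [adj x] moves the approximate unit to the other side. *)
Lemma approximate_unit_element (I : Type) (F : set_system I) (e : I -> A) :
  ProperFilter F -> approximate_unit F e ->
  forall x y (eps : R), 0 < eps ->
  exists i, [/\ adj (e i) = e i, rnorm (e i) <= 1,
    rnorm (x ** e i - x) < eps & rnorm (e i ** y - y) < eps].
Proof.
move=> FF [e_pos e_le1 e_unit] x y eps eps0.
have epsC : 0 < eps%:C by rewrite ltcR.
have [i [xi yi]] := filter_ex (filterI (cvgr_distC_lt _ _ (e_unit x).2 _ epsC)
                                       (cvgr_distC_lt _ _ (e_unit y).1 _ epsC)).
rewrite !normE !ltcR in xi yi.
exists i; split=> //; first exact: positive_adj.
by rewrite -lecR -normE.
Qed.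

Lemma cstar_gen_subalgebra (S : set A) : cstar_subalgebra (cstar_gen S).
Proof.
split.
- by move=> D [[]].
- move=> k x y Sx Sy D DS; have [[_ Dlin _ _ _] _] := DS.
  by apply: Dlin; [exact: Sx | exact: Sy].
- move=> x y Sx Sy D DS; have [[_ _ DM _ _] _] := DS.
  by apply: DM; [exact: Sx | exact: Sy].
- move=> x Sx D DS; have [[_ _ _ Dadj _] _] := DS.
  by apply: Dadj; exact: Sx.
by apply: closed_bigI => D [[]].
Qed.

End CstarAlgebra.

(** * Contractive positive functionals and their centralizers *)

Section ContractivePositiveFunctional.
Context {R : realType} {A : cstarAlgType R}.
Context {I : Type} {F : set_system I} {e : I -> A}.
Context {FF : ProperFilter F} (e_unit : approximate_unit F e).
Context {psi : A -> R[i]}.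
Hypothesis psi_linear :
  forall k x y, psi (k *: x + y) = k * psi x + psi y.
Hypothesis psi_pos : forall x, positive_in setT x -> 0 <= psi x.
Hypothesis psi_le : forall x, `|psi x| <= `|x|.
Implicit Types (x y v h n : A).

Let f x : R := complex.Re (psi x).

Lemma psi0 : psi 0 = 0.
Proof. by have := psi_linear (-1) 0 0; rewrite scaler0 addr0 mulN1r addNr. Qed.

Lemma psiD x y : psi (x + y) = psi x + psi y.
Proof. by have := psi_linear 1 x y; rewrite scale1r mul1r. Qed.

Lemma psiZ k x : psi (k *: x) = k * psi x.
Proof. by have := psi_linear k x 0; rewrite psi0 !addr0. Qed.

Lemma psiN x : psi (- x) = - psi x.
Proof. by rewrite -scaleN1r psiZ mulN1r. Qed.

Let fD x y : f (x + y) = f x + f y.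
Proof. by rewrite /f psiD ReD. Qed.

Let fZ (t : R) x : f (t%:C *: x) = t * f x.
Proof. by rewrite /f psiZ ReZ. Qed.

Let fN x : f (- x) = - f x.
Proof. by rewrite /f psiN; case: (psi x). Qed.

Let fB x y : f (x - y) = f x - f y.
Proof. by rewrite fD fN. Qed.

Let f_pos x : 0 <= f (x ** adj x).
Proof.
have := psi_pos (positive_in_mul_adj x).
by rewrite lecE => /andP[].
Qed.

Let f_le x : `|f x| <= rnorm x.
Proof.
by rewrite -lecR; apply: le_trans (normc_ge_Re _) _; rewrite -normE psi_le.
Qed.

(** Polarization: [psi] is real on both (x + y)(x + y)* and
    (x + iy)(x + iy)*. *)
Let f_sym x y : f (x ** adj y) = f (y ** adj x).
Proof.
have im z : complex.Im (psi (z ** adj z)) = 0.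
  exact/ger0_Im/psi_pos/positive_in_mul_adj.
have := im (x + 'i%C *: y).
rewrite adjD Defs.adjZ !(cmulDl, cmulDr) -!cscalerAl -!cscalerAr !psiD !psiZ.
rewrite /f; have := im x; have := im y.
have -> : Num.conj 'i%C = - 'i%C :> R[i].
  by rewrite -[RHS]conjCi.
case: (psi (x ** adj x)) => ? ? /=; case: (psi (y ** adj y)) => ? ? /=.
case: (psi (x ** adj y)) => ? ? /=; case: (psi (y ** adj x)) => ? ? /=.
lra.
Qed.

(** The discriminant of t |-> f ((x + t y) (x + t y)* ), with [t] real. *)
Lemma cauchy_schwarz x y :
  f (x ** adj y) ^+ 2 <= f (x ** adj x) * f (y ** adj y).
Proof.
set a := f (x ** adj x); set b := f (x ** adj y); set c := f (y ** adj y).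
have quad (t : R) : 0 <= a + 2 * t * b + t ^+ 2 * c.
  have := f_pos (x + t%:C *: y).
  rewrite adjD adjZ_real !(cmulDl, cmulDr) -!cscalerAl -!cscalerAr !fD !fZ.
  by rewrite [f (y ** adj x)]f_sym -/a -/b -/c; congr (_ <= _); ring.
have [c0|c_neq0] := eqVneq c 0.
  have : b = 0.
    (* The affine function a + 2 t b is -1 at t = - (a + 1) / (2 b). *)
    apply/eqP/negPn/negP => b0.
    have := quad (- (a + 1) / (2 * b)).
    have -> : a + 2 * (- (a + 1) / (2 * b)) * b + (- (a + 1) / (2 * b)) ^+ 2 * c
      = -1 by rewrite c0; field.
    by lra.
  by move=> ->; rewrite c0 mulr0 expr0n.
have c_gt0 : 0 < c by rewrite lt_neqAle eq_sym c_neq0 /c f_pos.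
have := quad (- b / c).
have -> : a + 2 * (- b / c) * b + (- b / c) ^+ 2 * c = (a * c - b ^+ 2) / c.
  by field.
by rewrite ler_pdivlMr // mul0r subr_ge0.
Qed.

(** Cauchy-Schwarz against an approximate unit. *)
Lemma cauchy_schwarz1 v : f v ^+ 2 <= f (v ** adj v).
Proof.
set q := f (v ** adj v); have q0 : 0 <= q by exact: f_pos.
rewrite -[q]sqr_sqrtr // -ler_sqrt ?exprn_ge0 ?sqrtr_ge0 //.
rewrite !sqrtr_sqr [leRHS]ger0_norm ?sqrtr_ge0 //.
apply/ler_addgt0Pr => eps eps0.
have [i [eE e1 ve _]] := approximate_unit_element FF e_unit v v eps0.
have le1 : `|f (v ** e i)| <= Num.sqrt q.
  rewrite -sqrtr_sqr ler_sqrt //.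
  rewrite -{1}eE; apply: le_trans (cauchy_schwarz _ _) _.
  rewrite ler_piMr //; apply: le_trans (ler_norm _) _.
  apply: le_trans (f_le _) _; apply: le_trans (rnormM _ _) _.
  by rewrite eE mulr_ile1 ?rnorm_ge0.
have : `|f v - f (v ** e i)| <= eps.
  by rewrite distrC -fB; apply: le_trans (f_le _) (ltW ve).
have := ler_distD (f (v ** e i)) (f v) 0; rewrite !subr0; lra.
Qed.

(** [f_sym] with y = e_i reads f (x e_i) = f (e_i x* ). *)
Let f_adj x : f (adj x) = f x.
Proof.
apply/eqP; rewrite eq_sym -subr_eq0 -normr_le0; apply/ler_addgt0Pr => eps eps0.
have eps2 : 0 < eps / 2 by rewrite divr_gt0.
have [i [eE e1 xe xe']] := approximate_unit_element FF e_unit x (adj x) eps2.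
have sym : f (x ** e i) = f (e i ** adj x).
  by have := f_sym x (e i); rewrite eE.
have := le_trans (f_le _) (ltW xe); have := le_trans (f_le _) (ltW xe').
rewrite !fB sym.
have := ler_distD (f (e i ** adj x)) (f x) (f (adj x)).
by rewrite [`|f x - f (e i ** _)|]distrC; lra.
Qed.

(** The positive functional z |-> f (v z v* ) has norm f (v v* ); iterated
    squaring of [h] extracts this sharp bound from f <= |.|. *)
Lemma contraction v h : adj h = h -> rnorm h <= 1 ->
  f (v ** h ** adj v) <= f (v ** adj v).
Proof.
move=> hE h1.
pose s k := iter k (fun z => z ** z) h.
have sE k : adj (s k) = s k by elim: k => //= k IH; rewrite adjM IH.
have s1 k : rnorm (s k) <= 1.
  elim: k => //= k IH; apply: le_trans (rnormM _ _) _.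
  by rewrite mulr_ile1 ?rnorm_ge0.
apply: (@le_of_squaring_bound R _ (rnorm v * rnorm v)
          (fun k => f (v ** s k ** adj v))).
- exact: f_pos.
- move=> k; have := cauchy_schwarz v (v ** s k).
  by rewrite adjM sE /= !cmulA.
- move=> k; apply: le_trans (ler_norm _) _; apply: le_trans (f_le _) _.
  apply: le_trans (rnormM _ _) _; rewrite rnorm_adj ler_wpM2r ?rnorm_ge0 //.
  apply: le_trans (rnormM _ _) _.
  by rewrite ler_piMr ?rnorm_ge0.
Qed.

(** ** Approximating an element by its triple product *)

Section Residual.
Context (n : A).

(** [residual k] is (1 - n n* )^k n, written without a unit. *)
Definition residual k : A := iter k (fun y => y - n ** adj n ** y) n.

Let h := n ** adj n.
(* This is h (1 - h)^k. *)
Let w k := residual k ** adj n.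

Let hE : adj h = h. Proof. by rewrite /h adjM adjK. Qed.

Lemma residualS k : residual k.+1 = residual k - n ** adj n ** residual k.
Proof. by []. Qed.

Let wS k : w k.+1 = w k - h ** w k.
Proof. by rewrite /w /residual /= cmulBl -!cmulA. Qed.

Let w_comm k : w k ** h = h ** w k.
Proof.
elim: k => [|k IH]; first exact: erefl.
by rewrite wS cmulBl cmulBr IH -[h ** w k ** h]cmulA IH.
Qed.

Lemma residual_mul_adj j k : residual k ** adj (residual j) = w (j + k).
Proof.
elim: j => [|j IH]; first exact: erefl.
rewrite addSn wS -w_comm -IH /= adjB adjM hE cmulBr.
by rewrite cmulA.
Qed.

Let wE k : adj (w k) = w k.
Proof.
rewrite {1}/w adjM adjK -[in RHS](addn0 k); exact: (residual_mul_adj k 0).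
Qed.

Let w_mul i j : w i ** w j = h ** w (i + j).
Proof.
elim: i => [|i IH]; first exact: erefl.
by rewrite addSn !wS cmulBl cmulBr -[h ** w i ** w j]cmulA IH.
Qed.

Hypothesis n_le1 : rnorm n <= 1.

(** With h = n n*, the value f (h (1 - h)^2k) decreases in k, and its decrement
    f (h^2 (1 - h)^2k (2 - h)) dominates f (h^2 (1 - h)^2k), hence the square
    of f (h (1 - h)^k). *)
Lemma residual_vanishes eps : 0 < eps ->
  exists K, forall k, (K <= k)%N -> f (residual k ** adj (residual k)) < eps.
Proof.
pose c k := f (residual k ** adj (residual k)).
have cE k : c k = f (w k.*2) by rewrite /c residual_mul_adj addnn.
have h1 : rnorm h <= 1.
  by apply: le_trans (rnormM _ _) _; rewrite rnorm_adj mulr_ile1 ?rnorm_ge0.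
have decr k : f (w k) ^+ 2 <= c k - c k.+1.
  have q_le := contraction (w k) hE h1.
  rewrite wE w_comm -cmulA w_mul addnn in q_le.
  apply: le_trans (cauchy_schwarz1 _) _; rewrite wE w_mul addnn.
  by rewrite !cE doubleS !wS cmulBr !fB; lra.
apply: (@vanishing_of_square_decrements _ c) => [k|k|j].
- exact: f_pos.
- by rewrite -subr_ge0; apply: le_trans (decr k); rewrite sqr_ge0.
- by rewrite {1}cE; exact: decr.
Qed.

End Residual.

(** That is, n* (1 - n n* )^k = (1 - n* n)^k n*. *)
Lemma adj_residual n k :
  adj (residual n k) = residual (adj n) k.
Proof.
have comm j : adj n ** n ** residual (adj n) j =
              residual (adj n) j ** (n ** adj n).
  elim: j => [|j IH]; first by rewrite /= -!cmulA.
  by rewrite residualS adjK cmulBr cmulBl IH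
     [adj n ** n ** (_ ** _)]cmulA IH.
elim: k => // k IH.
by rewrite !residualS adjB adjM adjM adjK IH -comm.
Qed.

(** The imaginary part of [psi] at [z] is minus its real part at [i z], and the
    scalar [i] can be moved into [a]. *)
Lemma centralized_byP x :
  centralized_by psi x <-> forall a, f (x ** a) = f (a ** x).
Proof.
split=> [cx a|cx a]; first by rewrite /f cx.
have := cx ('i%C *: a); have := cx a.
rewrite /f -cscalerAr -cscalerAl !psiZ.
case: (psi (x ** a)) => a1 b1; case: (psi (a ** x)) => a2 b2 /= -> /eqP.
by rewrite !mul0r !mul1r !sub0r eqr_opp => /eqP ->.
Qed.

Lemma centralizer_cstar_subalgebra :
  cstar_subalgebra [set x | centralized_by psi x].
Proof.
split=> /=.
- by move=> a; rewrite cmul0r cmulr0.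
- move=> k x y cx cy a.
  by rewrite cmulDl cmulDr -cscalerAl -cscalerAr !psi_linear cx cy.
- by move=> x y cx cy a; rewrite -cmulA cx -cmulA cy cmulA.
- move=> x /centralized_byP cx; apply/centralized_byP => a.
  by rewrite -f_adj adjM adjK -cx -f_adj adjM adjK.
move=> x clx; apply/centralized_byP => a.
apply/eqP; rewrite -subr_eq0 -normr_le0; apply/ler_addgt0Pr => eps eps0.
have a0 := rnorm_ge0 a.
pose d := eps / (2 * rnorm a + 1).
have d0 : 0 < d by rewrite divr_gt0 //; lra.
have dC : 0 < d%:C by rewrite ltcR.
have [y [/centralized_byP cy]] := clx _ (nbhsx_ballx x _ dC).
rewrite -ball_normE /= normE ltcR => xy.
have -> : f (x ** a) - f (a ** x) = f ((x - y) ** a) - f (a ** (x - y)).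
  by rewrite cmulBl cmulBr !fB cy; ring.
have le1 := le_trans (f_le _) (rnormM (x - y) a).
have le2 := le_trans (f_le _) (rnormM a (x - y)).
apply: le_trans (ler_normB _ _) _.
have dE : d * (2 * rnorm a + 1) = eps by rewrite divfK //; lra.
have := ler_wpM2r a0 (ltW xy).
rewrite [rnorm a * _]mulrC in le2; lra.
Qed.

(** Each [n - residual n k] centralizes [psi], so the commutator defect of [n]
    equals that of its residuals, which Cauchy-Schwarz bounds by the vanishing
    quantities of [residual_vanishes] for [n] and for [adj n]. *)
Lemma centralized_by_of_triple_product_contractive n : rnorm n <= 1 ->
  centralized_by psi (n ** adj n) -> centralized_by psi (n ** adj n ** n) ->
  centralized_by psi n.
Proof.
move=> n1 ch cn3.
have [c0 clin cM _ _] := centralizer_cstar_subalgebra; rewrite /= in c0 clin cM.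
have cB x y : centralized_by psi x -> centralized_by psi y ->
    centralized_by psi (x - y).
  by move=> cx cy; rewrite addrC -scaleN1r; exact: clin.
have c_res k : centralized_by psi (n - residual n k).
  elim: k => [|k IH]; first by rewrite subrr.
  have -> : n - residual n k.+1 =
      n - residual n k - (n ** adj n ** (n - residual n k) - n ** adj n ** n).
    rewrite cmulBr residualS [X in _ = _ - X]addrAC subrr add0r opprK.
    by rewrite opprB addrA addrAC.
  exact: cB IH (cB _ _ (cM _ _ ch IH) cn3).
apply/centralized_byP => x.
set D := f (n ** x) - f (x ** n).
have DE k : D = f (residual n k ** x) - f (x ** residual n k).
  have /centralized_byP/(_ x) := c_res k.
  by rewrite cmulBl cmulBr !fB /D; lra.
(* The constant in eps makes 2 (M + M') eps < D^2, against the estimate of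
   D^2 obtained at the end. *)
apply/eqP; rewrite -subr_eq0 -/D; apply/negPn/negP => D0.
have D2 : 0 < D ^+ 2 by rewrite exprn_even_gt0.
set M := f (adj x ** x); set M' := f (x ** adj x).
have M0 : 0 <= M by have := f_pos (adj x); rewrite adjK.
have M'0 : 0 <= M' by exact: f_pos.
pose eps := D ^+ 2 / (2 * (M + M') + 1).
have eps0 : 0 < eps by rewrite divr_gt0 //; lra.
have epsE : eps * (2 * (M + M') + 1) = D ^+ 2 by rewrite divfK //; lra.
have n1' : rnorm (adj n) <= 1 by rewrite rnorm_adj.
have [K1 hK1] := residual_vanishes n1 eps0.
have [K2 hK2] := residual_vanishes n1' eps0.
pose k := maxn K1 K2.
have := hK1 k (leq_maxl _ _); have := hK2 k (leq_maxr _ _).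
rewrite -adj_residual adjK; move: (DE k); set y := residual n k => Dy y2 y1.
have := cauchy_schwarz y (adj x); rewrite adjK -/M => cs1.
have := cauchy_schwarz x (adj y); rewrite adjK -/M' => cs2.
set p := f (y ** x) in Dy cs1; set q := f (x ** y) in Dy cs2.
have le1 : p ^+ 2 <= eps * M by apply: le_trans cs1 _; rewrite ler_wpM2r // ltW.
have le2 : q ^+ 2 <= M' * eps.
  by apply: le_trans cs2 _; rewrite ler_wpM2l // ltW.
have : D ^+ 2 <= 2 * p ^+ 2 + 2 * q ^+ 2.
  by rewrite Dy; have := sqr_ge0 (p + q); lra.
lra.
Qed.

Lemma centralized_by_of_triple_product n :
  centralized_by psi (n ** adj n) -> centralized_by psi (n ** adj n ** n) ->
  centralized_by psi n.
Proof.
move=> ch cn3.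
have [c0 clin _ _ _] := centralizer_cstar_subalgebra; rewrite /= in c0 clin.
have cZ k x : centralized_by psi x -> centralized_by psi (k *: x).
  by move=> cx; rewrite -[k *: x]addr0; apply: clin.
have n0 := rnorm_ge0 n.
(* Centralizing is a homogeneous condition, so [n] may be scaled down. *)
pose t := (1 + rnorm n)^-1.
have t0 : 0 < t by rewrite invr_gt0; lra.
have tn1 : rnorm (t%:C *: n) <= 1.
  have tE : t * (1 + rnorm n) = 1 by rewrite mulVf //; lra.
  by rewrite rnormZ ?ltW //; lra.
have tC : t%:C != 0 :> R[i] by rewrite gt_eqF // ltcR.
rewrite -[n]scale1r -(mulVf tC) -scalerA; apply: (cZ).
apply: centralized_by_of_triple_product_contractive => //.
- by rewrite adjZ_real -cscalerAl -cscalerAr; do 2! apply: (cZ).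
- by rewrite adjZ_real -!(cscalerAl, cscalerAr); do 3! apply: (cZ).
Qed.

End ContractivePositiveFunctional.

(** * States and normalizers *)

Section StatesAndNormalizers.
Context {R : realType} {A : cstarAlgType R}.
Implicit Types (B D : set A) (n x y : A).

Lemma state_norm_le D (phi : A -> R[i]) :
  cstar_subalgebra D -> state D phi -> forall x, D x -> `|phi x| <= `|x|.
Proof.
move=> [D0 Dlin _ _ _] [phi_lin _ phi_norm] x Dx.
have phi0 : phi 0 = 0.
  by have := phi_lin (-1) 0 0 D0 D0; rewrite scaler0 addr0 mulN1r addNr.
have phiZ k : phi (k *: x) = k * phi x.
  by have := phi_lin k x 0 Dx D0; rewrite phi0 !addr0.
have DZ k : D (k *: x) by rewrite -[k *: x]addr0; exact: Dlin.
have unit_le y : D y -> `|y| <= 1 -> `|phi y| <= 1.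
  move=> Dy y1; rewrite [`|phi y|]complex_ge0E // lecR -lee_fin -phi_norm.
  by apply: ereal_sup_ubound; exists y.
have [->|x0] := eqVneq x 0; first by rewrite phi0 !normr0.
have nx : 0 < `|x| by rewrite normr_gt0.
have := unit_le (`|x|^-1 *: x) (DZ _).
rewrite normrZ phiZ normrM normfV normr_id mulVf ?gt_eqF // => /(_ (lexx _)).
by rewrite mulrC ler_pdivrMr // mul1r.
Qed.

Lemma normalizer_adj B n : normalizers B n -> normalizers B (adj n).
Proof. by move=> Nn b Bb; rewrite adjK; have [] := Nn b Bb. Qed.

(** [n e n* ] tends to [n n* ] along an approximate unit of [B]. *)
Lemma normalizer_mul_adj B n : cstar_subalgebra B ->
  nondegenerate_subalgebra B -> normalizers B n -> B (n ** adj n).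
Proof.
move=> [_ _ _ _ clB] [I [F [e [FF e_unit Be]]]] Nn.
apply: closed_approx clB _ => eps eps0.
have d0 : 0 < eps / (rnorm n + 1).
  by rewrite divr_gt0 //; have := rnorm_ge0 n; lra.
have [i [_ _ _ ei]] := approximate_unit_element FF e_unit 0 (adj n) d0.
exists (n ** e i ** adj n); first by have [] := Nn _ (Be i).
rewrite -rnormN opprB -cmulA -cmulBr; apply: le_lt_trans (rnormM _ _) _.
have := rnorm_ge0 n => n0.
have dE : eps / (rnorm n + 1) * (rnorm n + 1) = eps by rewrite divfK //; lra.
have := ler_wpM2l n0 (ltW ei); lra.
Qed.

End StatesAndNormalizers.

(** * Invariance, centralization and traces *)

Unset Implicit Arguments.
Set Strict Implicit.

Theorem theorem1p7 (R : realType) (A : cstarAlgType R) (B : set A)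
    (B_sub : cstar_subalgebra B) (B_nondeg : nondegenerate_subalgebra B)
    (B_abelian : abelian_subalgebra B)
    (E : {linear A -> A}) (E_condexp : cond_expectation B E)
    (N0 : set A) (N0_norm : N0 `<=` normalizers B)
    (E_norm : forall n, N0 n -> normalized_by E n)
    (phi : A -> R[i]) (phi_state : state B phi) :
  [<-> set_invariant B phi N0;
       forall x, cstar_gen (B `|` N0) x -> centralized_by (phi \o E) x;
       tracial_state (cstar_gen (B `|` N0)) (phi \o E)].
Proof.
have [phi_lin phi_pos phi_norm] := phi_state.
have [EB Eid Ebimod Epos Ele] := E_condexp.
have BC : B `<=` cstar_gen (B `|` N0).
  by move=> b ?; apply: sub_gen_smallest; left.
have NC : N0 `<=` cstar_gen (B `|` N0).
  by move=> b ?; apply: sub_gen_smallest; right.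
have N_adj n : N0 n -> B (n ** adj n).
  by move=> /N0_norm; apply: normalizer_mul_adj.
have N_adj' n : N0 n -> B (adj n ** n).
  move=> /N0_norm Nn.
  have := normalizer_mul_adj B_sub B_nondeg (normalizer_adj Nn).
  by rewrite adjK.
have psi_lin k x y : (phi \o E) (k *: x + y) = k * (phi \o E) x + (phi \o E) y.
  by rewrite /= linearP phi_lin.
have psi_pos x : positive_in setT x -> 0 <= (phi \o E) x.
  by move=> /Epos /phi_pos.
have psi_le x : `|(phi \o E) x| <= `|x|.
  exact: le_trans (state_norm_le B_sub phi_state (EB x)) (Ele x).
tfae.
- move=> inv.
  have [I [F [e [FF e_unit _]]]] := B_nondeg.
  have cB b : B b -> centralized_by (phi \o E) b.
    move=> Bb a /=; have [-> ->] := Ebimod a b Bb.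
    by rewrite B_abelian.
  apply: smallest_sub.
    exact: (centralizer_cstar_subalgebra e_unit psi_lin psi_pos psi_le).
  move=> n [/cB//|Nn].
  (* Invariance under n extends from B to A because n normalizes E. *)
  have inv_psi a : (phi \o E) (n ** a ** adj n) = (phi \o E) (adj n ** n ** a).
    rewrite /= (E_norm n Nn) inv //.
    by have [-> _] := Ebimod a _ (N_adj' _ Nn).
  apply: (centralized_by_of_triple_product e_unit psi_lin psi_pos psi_le).
    exact/cB/N_adj.
  (* psi (n n* n a) = psi (n (a n) n* ) = psi (n* n a n) = psi (a n n* n). *)
  move=> a; rewrite -[_ ** n ** a]cmulA (cB _ (N_adj _ Nn)) !cmulA.
  rewrite -[n ** a ** n]cmulA inv_psi (cB _ (N_adj' _ Nn)).
  by rewrite !cmulA.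
- move=> cent; split; last by move=> x y Cx _; exact: cent.
  split.
  + by move=> k x y _ _; exact: psi_lin.
  + by move=> x [y _ ->]; apply: psi_pos; exists y.
  apply/eqP; rewrite eq_le; apply/andP; split.
    apply: ge_ereal_sup => _ [x [_ x1] <-].
    by rewrite lee_fin -lecR -complex_ge0E // (le_trans (psi_le x)).
  rewrite -phi_norm; apply: le_ereal_sup => _ [b [Bb b1] <-].
  by exists b; [split=> //; exact: BC | rewrite /= Eid].
- move=> [_ tr] n Nn b Bb.
  have BnB : B (n ** b ** adj n) by have [] := N0_norm n Nn b Bb.
  have [_ _ BM _ _] := B_sub.
  have [_ _ CM Cadj _] := cstar_gen_subalgebra (B `|` N0).
  have Bn2 := N_adj' n Nn.
  have := tr n (b ** adj n) (NC n Nn) (CM _ _ (BC b Bb) (Cadj _ (NC n Nn))).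
  rewrite /= cmulA -[b ** adj n ** n]cmulA !Eid //; last exact: BM.
  by move=> ->; rewrite B_abelian.
Qed.
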